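(* Let $d\ge 1$. For any Cantor set $E\subset \mathbb{R}^d$, there exists a dense $G_{\delta}$ set $G\subset\mathbb{R}^d$ such that $G$ does not contain an affine copy of $E$. Consequently, there do not exist any topologically universal Cantor sets on $\mathbb{R}^d$.
   Context: A Cantor set in $\mathbb{R}^d$ is a nonempty, totally disconnected, perfect and compact subset of $\mathbb{R}^d$. An affine copy of a set $E\subset\mathbb{R}^d$ is a set of the form $t+T(E)$ where $t\in\mathbb{R}^d$ and $T$ is an invertible linear transformation on $\mathbb{R}^d$. A set $E\subset\mathbb{R}^d$ is topologically universal if every dense $G_\delta$ set in $\mathbb{R}^d$ contains an affine copy of $E$. *)

(* Defs.v *)
From HB Require Import structures.
From mathcomp Require Import all_boot all_order all_algebra.
From mathcomp Require Import all_classical all_reals all_analysis.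
From mathcomp Require Import borel_hierarchy.

Set Implicit Arguments.
Unset Strict Implicit.
Unset Printing Implicit Defensive.

Import Order.TTheory GRing.Theory Num.Theory.
Import numFieldNormedType.Exports.

Local Open Scope classical_set_scope.
Local Open Scope ring_scope.

(* R^d is the space of row vectors 'rV[R]_d with the library's matrix
   topology (the product topology, induced by the sup norm), which is the
   Euclidean topology. *)

Definition cantor_set (R : realType) (d : nat) (E : set 'rV[R]_d) : Prop :=
  [/\ E !=set0, totally_disconnected E, perfect_set E & compact E].

(* Argument order: F is an affine copy of E. *)
Definition affine_copy (R : realType) (d : nat) (E F : set 'rV[R]_d) : Prop :=
  exists (t : 'rV[R]_d) (T : {linear 'rV[R]_d -> 'rV[R]_d}),
    bijective T /\ F = [set t + T x | x in E].

Definition contains_affine_copy (R : realType) (d : nat)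
    (G E : set 'rV[R]_d) : Prop :=
  exists F : set 'rV[R]_d, affine_copy E F /\ F `<=` G.

(* The library's Gdelta_dense asks for an intersection of dense open sets;
   here, as usual, a dense G_delta set is a G_delta set that is dense. *)
Definition dense_Gdelta (R : realType) (d : nat) (G : set 'rV[R]_d) : Prop :=
  Gdelta G /\ dense G.

Definition topologically_universal (R : realType) (d : nat)
    (E : set 'rV[R]_d) : Prop :=
  forall G : set 'rV[R]_d, dense_Gdelta G -> contains_affine_copy G E.

(* Main.v *)
Require Import Defs.
From HB Require Import structures.
From mathcomp Require Import all_boot all_order all_algebra.
From mathcomp Require Import all_classical all_reals all_analysis.
From mathcomp Require Import borel_hierarchy.
From mathcomp Require Import lra.

Set Implicit Arguments.
Unset Strict Implicit.
Unset Printing Implicit Defensive.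

Import Order.TTheory GRing.Theory Num.Theory.
Import numFieldNormedType.Exports.

Local Open Scope classical_set_scope.
Local Open Scope ring_scope.

(** Cover the points of the grid of mesh [2 ^- n] by very small open balls, of
    radius [rho n], and let [G] be the set of points that belong to such balls
    for infinitely many [n].  It is a G_delta set, and it is dense because it
    contains all dyadic points.  The radii [rho n] can be chosen, depending on
    the Cantor set [E] only, so that [G] contains no affine copy of [E].

    The reason is that a compact perfect set has points at all scales, in a
    uniform way: for each [r > 0] there is [s > 0] such that every point of [E]
    has another point of [E] at distance between [s] and [r] from it
    ([compact_perfect_gap]).  An affine bijection [f] of R^d distorts distances
    by a bounded factor [K].  Take a piece of [E] whose image is small compared
    with the mesh [2 ^- n]: it can meet at most one ball of level [n].  If
    [rho n] is small compared with the lower scale [s] of the piece, that ball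
    cannot contain the images of two points of the piece at distance [s], so
    one of these points is mapped outside the balls of level [n], and so is a
    smaller piece of [E] around it.  Iterating over the levels [n >= K] and
    using compactness gives a point of [E] whose image is in no ball of level
    at least [K] ([avoid_nets]), hence not in [G].  Level [n] is designed to
    cope with all distortion factors up to [n + 1], so that a single sequence of
    radii ([exists_scales]) serves for all affine maps. *)

(** * Uniform gaps in compact perfect sets *)

(** A quantitative form of perfectness at scale [r]: unlike the mere existence
    of nearby points, the lower bound [s] is uniform in the base point. *)
Definition gap (R : realType) (V : normedModType R) (E : set V) (s r : R) :=
  forall x, E x -> exists y, [/\ E y, s <= `|x - y| & `|x - y| <= r].

(** Around a point [x] of [E] pick [y] in [E] distinct from [x] and closer than
    [r / 2]: half the distance from [x] to [y] is a lower scale valid for all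
    base points close to [x].  Compactness makes the lower scale uniform. *)
Lemma compact_perfect_gap (R : realType) (V : normedModType R) (E : set V) :
  compact E -> E `<=` limit_point E ->
  forall r : R, 0 < r -> exists s : R, [/\ 0 < s, s <= r & gap E s r].
Proof.
move=> /compact_near_coveringP cE pE r r0.
have H := cE _ (0^'+ : set_system R)
  (fun s x => exists y, [/\ E y, s <= `|x - y| & `|x - y| <= r]) _.
have {}H : \forall s \near 0^'+,
    E `<=` (fun x => exists y, [/\ E y, s <= `|x - y| & `|x - y| <= r]).
  apply: H => x Ex.
  have r20 : 0 < r / 2 by lra.
  have [y [yx Ey xy]] := pE _ Ex _ (nbhsx_ballx x _ r20).
  have d0 : 0 < `|x - y| by rewrite normr_gt0 subr_eq0 eq_sym.
  have d20 : 0 < `|x - y| / 2 by lra.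
  exists (ball x (`|x - y| / 2), [set s | 0 < s < `|x - y| / 2]).
    split => /=; first exact: nbhsx_ballx.
    near=> s; apply/andP; split => //.
  case=> x' s /= [xx' /andP[s0 sd]]; exists y.
  move: xy xx'; rewrite -!ball_normE /= => xy xx'.
  have := ler_distD x' x y; have := ler_distD x x' y.
  rewrite (distrC x' x).
  by split => //; lra.
have : \forall s \near 0^'+, [/\ 0 < s, s <= r & gap E s r].
  near=> s; split => //.
    by near: s; exact: nbhs_right_le.
  by near: s; exact: H.
by move/(@filter_ex _ _ _).
Unshelve. all: by end_near.
Qed.

(** * Choice of the radii *)

(** The radii of the construction.  At level [n] a piece of [E] of radius [r n]
    is confronted with balls of radius [rho n] around an [eps n]-separated net,
    and maps that distort distances by a factor at most [n + 1] are taken care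
    of.  The third clause makes the image of the piece so small that it can
    meet only one doubled ball, the last one makes the piece contain two points
    whose images do not both fit in that doubled ball, and the fourth one makes
    the piece of the next level lie within the present one and have an image
    smaller than the margin [rho n] left by the doubling. *)
Definition adapted_scales (R : realType) (V : normedModType R) (E : set V)
    (eps r rho : nat -> R) :=
  forall n,
    [/\ 0 < rho n, 0 < r n,
        n.+1%:R * r n + 4 * rho n <= eps n,
        n.+1%:R * r n.+1 <= rho n /\ r n.+1 <= r n / 2
      & gap E (4 * n.+1%:R * rho n) (r n / 2)].

Lemma exists_scales (R : realType) (V : normedModType R) (E : set V)
    (eps : nat -> R) :
  (forall r : R, 0 < r -> exists s : R, [/\ 0 < s, s <= r & gap E s r]) ->
  (forall n, 0 < eps n) ->
  exists r rho : nat -> R, adapted_scales E eps r rho.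
Proof.
move=> gapE eps0.
have /choice [s sP] : forall r : R, exists s : R,
    0 < r -> [/\ 0 < s, s <= r & gap E s r].
  move=> r; have [r0|r0] := ltP 0 r; last by exists 0.
  by have [s sP] := gapE _ r0; exists s.
pose rh n r : R := s (r / 2) / (4 * n.+1%:R).
(* [r] is built by recursion because the radius [rho n] depends on the gap of
   [E] at scale [r n / 2], and [r n.+1] has to be small relative to [rho n]. *)
pose r := fix r n : R := if n is m.+1 then
  Num.min (rh m (r m) / m.+1%:R) (eps n / (n.+2%:R)) else eps 0 / 2.
have N0 n : 0 < n.+1%:R :> R by [].
have rh0 n (x : R) : 0 < x -> 0 < rh n x.
  move=> x0; have /sP[s0 _ _] : 0 < x / 2 by lra.
  exact: divr_gt0.
have r0 n : 0 < r n.
  elim: n => [|n IH] /=; first by have := eps0 0%N; lra.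
  by rewrite lt_min; apply/andP; split; apply: divr_gt0 => //; exact: rh0.
have rhle n (x : R) : 0 < x -> 4 * n.+1%:R * rh n x <= x / 2.
  move=> x0; have /sP[s0 sx _] : 0 < x / 2 by lra.
  by rewrite mulrC divfK // gt_eqF // mulr_gt0.
have rh8 n (x : R) : 0 < x -> 8 * rh n x <= x.
  move=> x0; have := rhle n x x0; have := rh0 n x x0.
  have : 1 <= n.+1%:R :> R by rewrite ler1n.
  nra.
pose rho n : R := rh n (r n).
exists r, rho => n; split => //.
- exact: rh0.
- have : 8 * rho n <= r n := rh8 n _ (r0 n).
  suff : n.+2%:R * r n <= eps n.
    by rewrite -[n.+2%:R]natr1 mulrDl mul1r; have := r0 n; lra.
  case: n => [|n] /=; first lra.
  rewrite mulrC -ler_pdivlMr //.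
  by rewrite ge_min lexx orbT.
- have h : n.+1%:R * r n.+1 <= rho n.
    by rewrite mulrC -ler_pdivlMr //= ge_min lexx.
  split => //; have : 8 * rho n <= r n := rh8 n _ (r0 n); have := r0 n.+1.
  have : 1 <= n.+1%:R :> R by rewrite ler1n.
  have : 0 < rho n := rh0 n _ (r0 n).
  nra.
- have /sP[s0 sx g] : 0 < r n / 2 by have := r0 n; lra.
  by rewrite mulrC divfK // gt_eqF // mulr_gt0.
Qed.

(** * Escaping the balls *)

(** The image of [E] escapes any finite number of levels, by induction on
    their number: if it escapes the earlier ones on the part of [E] at distance
    at most [r N] from [x], then this part contains a second point [y] of [E] at
    a distance from [x] controlled on both sides.  Both images cannot be within
    [2 * rho N] of the net: they would be so for the same net point, as the
    image of the part is small compared with the separation of the net, and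
    then they would be too close to each other.  So the part of [E] around [x]
    or around [y] at scale [r N.+1] serves for the next level. *)
Lemma avoid_finitely_many_nets (R : realType) (V W : normedModType R)
    (E : set V) (D : nat -> set W) (eps r rho : nat -> R) (f : V -> W)
    (K : R) (k m : nat) :
  E !=set0 ->
  (forall n a b, D n a -> D n b -> `|a - b| < eps n -> a = b) ->
  adapted_scales E eps r rho ->
  (forall x y, `|f x - f y| <= K * `|x - y|) ->
  (forall x y, `|x - y| <= K * `|f x - f y|) ->
  K <= k%:R ->
  exists2 x, E x & forall y, E y -> `|x - y| <= r (k + m)%N ->
    forall n a, (k <= n < k + m)%N -> D n a -> rho n <= `|f y - a|.
Proof.
move=> [x0 Ex0] sepD scales fK Kf Kk.
elim: m => [|m [x Ex xP]].
  exists x0 => // y _ _ n a; rewrite addn0.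
  by move=> /andP[kn nk]; have := leq_ltn_trans kn nk; rewrite ltnn.
rewrite addnS; set N := (k + m)%N in xP *.
have KN : K <= N.+1%:R.
  by apply: le_trans Kk _; rewrite ler_nat; exact/leqW/leq_addr.
have fN u v : `|f u - f v| <= N.+1%:R * `|u - v|.
  by apply: le_trans (fK u v) _; rewrite ler_wpM2r.
have Nf u v : `|u - v| <= N.+1%:R * `|f u - f v|.
  by apply: le_trans (Kf u v) _; rewrite ler_wpM2r.
have [rho0 r0 Hr [Hr1 Hr2] gE] := scales N.
have [y [Ey ylo yhi]] := gE _ Ex.
have N1 : 1 <= N.+1%:R :> R by rewrite ler1n.
(* The factor 2 leaves a margin [rho N] for moving from [z] to the points of
   [E] around [z]. *)
have [z [Ez xz zP]] : exists z, [/\ E z, `|x - z| <= r N / 2 &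
    forall a, D N a -> 2 * rho N <= `|f z - a|].
  apply: contrapT => /forallNP noz.
  have near_net z : E z -> `|x - z| <= r N / 2 ->
      exists2 a, D N a & `|f z - a| < 2 * rho N.
    move=> Ez xz; apply: contrapT => na; apply: (noz z); split => // a Da.
    by rewrite leNgt; apply/negP => za; apply: na; exists a.
  have [|a Da xa] := near_net x Ex; first by rewrite subrr normr0; lra.
  have [b Db yb] := near_net y Ey yhi.
  have fxy := fN x y.
  have ab : a = b.
    apply: sepD Da Db _.
    have := ler_distD (f x) a b; have := ler_distD (f y) (f x) b.
    rewrite (distrC a (f x)).
    nra.
  rewrite -ab in yb.
  have := ler_distD a (f x) (f y); rewrite (distrC a (f y)).
  have := Nf x y.
  nra.
exists z => // w Ew zw n a /andP[kn].
rewrite ltnS leq_eqVlt => /orP[/eqP ->|nN] Da.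
  have := zP a Da; have := ler_distD (f w) (f z) a; have := fN z w.
  nra.
apply: (xP w) => //; last by rewrite kn nN.
have := ler_distD z x w; lra.
Qed.

(** If every point of [E] had its image in one of the balls, these being open,
    compactness would yield a finite number of levels that suffice for all of
    [E], which [avoid_finitely_many_nets] excludes. *)
Lemma avoid_nets (R : realType) (V W : normedModType R) (E : set V)
    (D : nat -> set W) (eps r rho : nat -> R) (f : V -> W) (K : R) (k : nat) :
  compact E -> E !=set0 ->
  (forall n a b, D n a -> D n b -> `|a - b| < eps n -> a = b) ->
  adapted_scales E eps r rho ->
  (forall x y, `|f x - f y| <= K * `|x - y|) ->
  (forall x y, `|x - y| <= K * `|f x - f y|) ->
  K <= k%:R ->
  exists2 x, E x & forall n a, (k <= n)%N -> D n a -> rho n <= `|f x - a|.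
Proof.
move=> cE E0 sepD scales fK Kf Kk.
apply: contrapT => nx.
have H := (compact_near_coveringP E).1 cE nat \oo
  (fun m x => exists n a, [/\ (k <= n < m)%N, D n a & `|f x - a| < rho n]) _.
have {}H : \forall m \near \oo, E `<=` (fun x =>
    exists n a, [/\ (k <= n < m)%N, D n a & `|f x - a| < rho n]).
  apply: H => x Ex.
  have [n [a [kn Da fxa]]] : exists n a,
      [/\ (k <= n)%N, D n a & `|f x - a| < rho n].
    apply: contrapT => nn; apply: nx; exists x => // n a kn Da.
    by rewrite leNgt; apply/negP => ?; apply: nn; exists n, a.
  have K10 : 0 < `|K| + 1 by have := normr_ge0 K; lra.
  have e0 : 0 < (rho n - `|f x - a|) / (`|K| + 1).
    by rewrite divr_gt0 ?subr_gt0.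
  exists (ball x ((rho n - `|f x - a|) / (`|K| + 1)), [set m | (n < m)%N]).
    split => /=; first exact: nbhsx_ballx.
    by exists n.+1 => //= m.
  case=> y m /= [xy nm]; exists n, a; rewrite kn nm; split => //.
  move: xy; rewrite -ball_normE /= (ltr_pdivlMr _ _ K10).
  have := ler_distD (f x) (f y) a; have := fK y x; rewrite (distrC y x).
  have := ler_wpM2r (normr_ge0 (x - y)) (ler_norm K); have := normr_ge0 (x - y).
  lra.
have [m Hm] := filter_ex H.
have [x Ex xP] := avoid_finitely_many_nets m E0 sepD scales fK Kf Kk.
have [n [a [/andP[kn nm] Da fxa]]] := Hm x Ex.
have [_ rm _ _ _] := scales (k + m)%N.
have := xP x Ex _ n a _ Da.
rewrite subrr normr0 (ltW rm) kn (leq_trans nm) ?leq_addl //.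
by move=> /(_ isT isT); rewrite leNgt fxa.
Qed.

(** * Distortion of linear bijections *)

(** Coordinatewise expansion of [x] in the canonical basis. *)
Lemma linear_bound (R : realType) (W : normedModType R) (d : nat)
    (T : {linear 'rV[R]_d -> W}) :
  exists2 K : R, 0 <= K & forall x, `|T x| <= K * `|x|.
Proof.
exists (\sum_j `|T (delta_mx 0 j)|); first by apply: sumr_ge0.
move=> x; rewrite {1}(row_sum_delta x) linear_sum.
apply: le_trans (ler_norm_sum _ _ _) _; rewrite mulr_suml.
apply: ler_sum => j _; rewrite linearZ normrZ mulrC ler_wpM2l //.
rewrite [leRHS]/Num.norm /= mx_normrE; apply/bigmax_geP; right => /=.
by exists (ord0, j).
Qed.

Lemma bijective_linear_bilipschitz (R : realType) (d : nat)
    (T : {linear 'rV[R]_d -> 'rV[R]_d}) :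
  bijective T ->
  exists2 K : R, 0 <= K & forall x, `|T x| <= K * `|x| /\ `|x| <= K * `|T x|.
Proof.
move=> [S TK SK].
have linS : linear S by apply: (can2_linear TK SK).
pose S' : {linear 'rV[R]_d -> 'rV[R]_d} :=
  HB.pack S (GRing.isLinear.Build _ _ _ _ S linS).
have [K1 K10 TK1] := linear_bound T.
have [K2 K20 SK2] := linear_bound S'.
exists (K1 + K2) => [|x]; first exact: addr_ge0.
split.
  by apply: le_trans (TK1 x) _; rewrite ler_wpM2r // lerDl.
rewrite -{1}(TK x); apply: le_trans (SK2 (T x)) _.
by rewrite ler_wpM2r // lerDr.
Qed.

(** * Dyadic points *)

Definition dyadic (R : realType) (d n : nat) : set 'rV[R]_d :=
  [set v | forall j, v 0 j * 2 ^+ n \is a Num.int].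

Lemma row_norm_lt (R : realType) (d : nat) (v : 'rV[R]_d) (e : R) :
  0 < e -> (`|v| < e) <-> forall j, `|v 0 j| < e.
Proof.
move=> e0; rewrite [`|v|]/Num.norm /= mx_normrE; split.
  by move/bigmax_ltP => [_ h] j; exact: (h (0, j)).
by move=> h; apply/bigmax_ltP; split => // -[i j] _ /=; rewrite ord1.
Qed.

Lemma dyadic_separated (R : realType) (d n : nat) (a b : 'rV[R]_d) :
  dyadic n a -> dyadic n b -> `|a - b| < (2 ^+ n)^-1 -> a = b.
Proof.
move=> Da Db; rewrite row_norm_lt ?invr_gt0 ?exprn_gt0 // => ab.
apply/rowP => j; apply/eqP; rewrite -subr_eq0.
have n0 : 0 < 2 ^+ n :> R by rewrite exprn_gt0.
have : (a 0 j - b 0 j) * 2 ^+ n \is a Num.int by rewrite mulrBl rpredB ?Da ?Db.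
move=> /norm_intr_ge1; rewrite mulf_eq0 (gt_eqF n0) orbF.
case: eqVneq => //= _ /(_ isT).
rewrite normrM (gtr0_norm n0) leNgt -ltr_pdivlMr // div1r.
by have := ab j; rewrite !mxE => ->.
Qed.

Lemma dyadic_nested (R : realType) (d n m : nat) : (n <= m)%N ->
  @dyadic R d n `<=` dyadic m.
Proof.
move=> nm v Dv j; rewrite -(subnKC nm) exprD mulrA.
by rewrite rpredM ?Dv // rpredX // rpred_nat.
Qed.

(** Rounding down each coordinate to a multiple of [2 ^- n]. *)
Lemma dyadic_dense (R : realType) (d : nat) :
  dense (\bigcup_n @dyadic R d n).
Proof.
move=> O [x Ox] oO.
have /nbhs_ballP[e /= e0 xeO] := open_nbhs_nbhs (conj oO Ox).
have [n ne] : exists n, (2 ^+ n)^-1 < e.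
  exists (Num.bound e^-1).
  rewrite invf_plt ?posrE ?exprn_gt0 //.
  apply: lt_trans (archi_boundP _) _; first by rewrite invr_ge0 ltW.
  by rewrite -natrX ltr_nat ltn_expl.
have n0 : 0 < 2 ^+ n :> R by rewrite exprn_gt0.
pose v : 'rV[R]_d := \row_j ((Num.floor (x 0 j * 2 ^+ n))%:~R / 2 ^+ n).
exists v; split; last first.
  by exists n => // j; rewrite mxE divfK ?gt_eqF // intr_int.
apply: xeO; rewrite -ball_normE /= row_norm_lt // => j.
apply: le_lt_trans ne; rewrite !mxE.
have -> : x 0 j - (Num.floor (x 0 j * 2 ^+ n))%:~R / 2 ^+ n =
    (x 0 j * 2 ^+ n - (Num.floor (x 0 j * 2 ^+ n))%:~R) / 2 ^+ n.
  by rewrite mulrBl mulfK ?gt_eqF.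
rewrite normrM (gtr0_norm (x := _^-1)) ?invr_gt0 //.
rewrite ger_pMl ?invr_gt0 // ger0_norm ?subr_ge0 ?Num.Theory.floor_le //.
have := Num.Theory.floorD1_gt (x 0 j * 2 ^+ n); rewrite intrD; lra.
Qed.

(** * The dense G_delta set *)

(** The witness is the set of points lying in infinitely many of the ball
    families.  It contains every dyadic point, since such a point is a centre
    at all levels from some level on, whence the density.  A map distorting
    distances by a factor at most [K] is handled by the levels from [K] on, so
    that it sends some point of [E] outside one of the tails [U k]. *)
Lemma cantor_set_avoidable (R : realType) (d : nat) (E : set 'rV[R]_d) :
  cantor_set E ->
  exists G : set 'rV[R]_d, dense_Gdelta G /\ ~ contains_affine_copy G E.
Proof.
move=> [E0 _ [_ limE] cE].
have EE : E `<=` limit_point E by rewrite limE.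
have eps0 n : 0 < (2 ^+ n)^-1 :> R by rewrite invr_gt0 exprn_gt0.
have [r [rho scales]] := exists_scales (compact_perfect_gap cE EE) eps0.
pose U k := \bigcup_(n in [set n | (k <= n)%N])
  \bigcup_(a in @dyadic R d n) ball a (rho n).
exists (\bigcap_k U k); split; first split.
- exists U => // k; apply: bigcup_open => n _; apply: bigcup_open => a _.
  exact: ball_open.
- move=> O O0 oO; have [v [Ov [n _ Dv]]] := dyadic_dense O0 oO.
  exists v; split => // k _.
  exists (maxn k n); first exact: leq_maxl.
  exists v; first by apply: dyadic_nested Dv; exact: leq_maxr.
  by apply: ballxx; case: (scales (maxn k n)).
move=> [_ [[t [T [/bijective_linear_bilipschitz[K K0 TK] ->]]]] TEG].
have [|||x Ex xP] := @avoid_nets _ _ _ E (@dyadic R d) _ r rho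
    (fun x => t + T x) K (Num.bound K) cE E0 (@dyadic_separated R d) scales.
- by move=> x y; rewrite opprD addrACA subrr add0r -linearB; case: (TK (x - y)).
- by move=> x y; rewrite opprD addrACA subrr add0r -linearB; case: (TK (x - y)).
- exact/ltW/Num.Theory.archi_boundP.
have /TEG/(_ (Num.bound K) I) [n kn [a Da]] :
    [set t + T x | x in E] (t + T x) by exists x.
by rewrite -ball_normE /= distrC ltNge xP.
Qed.

Theorem theorem1p4 (R : realType) (d : nat) (hd : (1 <= d)%N) :
  (forall E : set 'rV[R]_d, cantor_set E ->
     exists G : set 'rV[R]_d, dense_Gdelta G /\ ~ contains_affine_copy G E) /\
  ~ (exists E : set 'rV[R]_d, cantor_set E /\ topologically_universal E).
Proof.
split; first by move=> E; exact: cantor_set_avoidable.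
move=> [E [/cantor_set_avoidable[G [Gd nG]] univE]].
exact/nG/univE.
Qed.
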